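(* Let $\nu$ be an admissible profile with $\alpha_{\min}\in\mathbb{R}$ which is concave, and let $\eta(p)=\inf_{\alpha\ge\alpha_{\min}}(\alpha p-\nu(\alpha)+1)$, $p>0$, be its concave conjugate. Then the function $\eta'$ defined for $p'>1$ by $$\eta'(p'):=(p'-1)\Big(1-\eta\Big(\frac{p'}{p'-1}\Big)\Big)+1$$ is convex, and for all $\alpha'\in[\alpha'_{\min},\alpha'_{\max})$ the dual profile $\nu'$ of $\nu$ satisfies $$\nu'(\alpha')=\sup_{p'>1}\big(\alpha'p'-\eta'(p')+1\big).$$
   Context: An admissible profile is a non-decreasing right-continuous function $\nu:\mathbb{R}\to\{-\infty\}\cup[0,1]$ that is not identically $-\infty$. Put $\alpha_{\min}=\inf\{\alpha:\nu(\alpha)\ge0\}$, with $\inf\emptyset=+\infty$. Concavity is understood for $\nu$ as a function on $\mathbb{R}$ with values in $\{-\infty\}\cup\mathbb{R}$ (equivalently, $\nu$ is concave on $[\alpha_{\min},\infty)$). Dual profile: put $[\![\beta]\!]=-\infty$ if $\beta<0$, $[\![\beta]\!]=\beta$ if $0\le\beta\le1$, $[\![\beta]\!]=1$ if $\beta\ge1$ (including $\beta=+\infty$). The dual profile of $\nu$ is $\nu':\alpha'\mapsto[\![\alpha'+\inf\{\alpha:\nu(\alpha)-\alpha>\alpha'\}]\!]$. The corresponding numbers are $\alpha'_{\min}=\inf\{\alpha':\nu'(\alpha')\ge0\}$ and $\alpha'_{\max}=\inf\{\alpha':\nu'(\alpha')=1\}$. The symbols $\nu'$ and $\eta'$ do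 not denote derivatives. *)

(* Defs.v *)
From mathcomp Require Export all_boot all_order all_algebra.
From mathcomp Require Export all_classical all_reals all_analysis.

Set Implicit Arguments.
Unset Strict Implicit.
Unset Printing Implicit Defensive.

Import Order.TTheory GRing.Theory Num.Theory.
Import numFieldNormedType.Exports.

Local Open Scope classical_set_scope.
Local Open Scope ring_scope.
Local Open Scope ereal_scope.

Record admissible_profile {R : realType} (nu : R -> \bar R) : Prop := {
  profile_range : forall a : R, nu a = -oo \/ 0 <= nu a <= 1;
  profile_nondecreasing : forall a b : R, (a <= b)%R -> nu a <= nu b;
  profile_right_continuous : right_continuous nu;
  profile_proper : exists a : R, nu a <> -oo }.

(* [ereal_inf set0 = +oo]. *)
Definition alpha_min {R : realType} (nu : R -> \bar R) : \bar R :=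
  ereal_inf [set a%:E | a in [set a : R | 0 <= nu a]].

Definition alpha_max {R : realType} (nu : R -> \bar R) : \bar R :=
  ereal_inf [set a%:E | a in [set a : R | nu a = 1]].

(* Concavity of a function with values in {-oo} U R; the weights are taken
   strictly between 0 and 1, so the convention for [0 * -oo] plays no role. *)
Definition concave_profile {R : realType} (nu : R -> \bar R) : Prop :=
  forall x y t : R, (0 < t < 1)%R ->
    t%:E * nu x + (1 - t)%:E * nu y <= nu (t * x + (1 - t) * y)%R.

Definition clamp {R : realType} (x : \bar R) : \bar R :=
  if x < 0 then -oo else if x <= 1 then x else 1.

Definition dual_profile {R : realType} (nu : R -> \bar R) (a' : R) : \bar R :=
  clamp (a'%:E
    + ereal_inf [set a%:E | a in [set a : R | a'%:E < nu a - a%:E]]).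

Definition concave_conjugate {R : realType} (nu : R -> \bar R) (p : R) : \bar R :=
  ereal_inf [set (a * p)%:E - nu a + 1
            | a in [set a : R | alpha_min nu <= a%:E]].

(* The function written eta' in terms of eta = [concave_conjugate nu]; it is meaningful
   for p' > 1 only. *)
Definition dual_conjugate {R : realType} (nu : R -> \bar R) (p' : R) : \bar R :=
  (p' - 1)%:E * (1 - concave_conjugate nu (p' / (p' - 1))%R) + 1.

(* [concave_conjugate nu] and [dual_conjugate nu] are real-valued on their domains, so
   [fine] loses no information there. *)
Lemma concave_conjugate_fin_num (R : realType) (nu : R -> \bar R) (p : R) :
  admissible_profile nu -> alpha_min nu \is a fin_num -> (0 < p)%R ->
  concave_conjugate nu p \is a fin_num.
Proof.
move=> [nu01 _ _ [a /eqP nua]] amin p0.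
have lb : (fine (alpha_min nu) * p)%:E <= concave_conjugate nu p.
  apply: le_ereal_inf_tmp => _ [b /= + <-].
  rewrite -{1}(fineK amin) lee_fin => mb.
  have mbp : (fine (alpha_min nu) * p <= b * p)%R by rewrite ler_wpM2r// ltW.
  case: (nu01 b) => [->|/andP[]]; first by rewrite leey.
  case: (nu b) => [r| |]//; rewrite !lee_fin => r0 r1.
  by rewrite -addrA (le_trans mbp)// lerDl addrC subr_ge0.
have ub : concave_conjugate nu p <= (a * p + 1)%:E.
  case: (nu01 a) => [/eqP|/andP[r0 r1]]; first by rewrite (negbTE nua).
  apply: (@le_trans _ _ ((a * p)%:E - nu a + 1)).
    by apply: ereal_inf_lbound; exists a => //=; apply: ereal_inf_lbound; exists a.
  move: r0 r1; case: (nu a) => [r| |]//; rewrite !lee_fin => r0 r1.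
  by rewrite lerD2r gerBl.
by rewrite fin_numE -ltNye -ltey (lt_le_trans (ltNyr _) lb)
  (le_lt_trans ub (ltry _)).
Qed.

Lemma dual_conjugate_fin_num (R : realType) (nu : R -> \bar R) (p' : R) :
  admissible_profile nu -> alpha_min nu \is a fin_num -> (1 < p')%R ->
  dual_conjugate nu p' \is a fin_num.
Proof.
move=> nuP amin p1; rewrite /dual_conjugate.
have : concave_conjugate nu (p' / (p' - 1))%R \is a fin_num.
  by apply: concave_conjugate_fin_num => //; rewrite divr_gt0 ?subr_gt0// (lt_trans _ p1).
by case: (concave_conjugate _ _).
Qed.

(* Main.v *)
(* Substituting the definition of eta,
   eta'(p') = sup_a (p' (nu a - a) - nu a) + 1 is a supremum of affine
   functions of p', hence convex. With q = p' - 1 > 0, the right-hand side of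
   the duality formula becomes a' + sup_q inf_a (a - q (nu a - a - a')), which
   is the Lagrangian dual of minimizing a subject to nu a - a > a'; let m be
   the value of the latter. Weak duality gives "<=". Conversely, for
   c < m a line of slope k > 0 through (c, a') lies above the concave function
   nu a - a, and the multiplier q = 1 / k yields a dual value at least c. *)
Require Import Defs.
From mathcomp Require Import all_boot all_order all_algebra.
From mathcomp Require Import all_classical all_reals all_analysis.
From mathcomp Require Import ring lra.

Import Order.TTheory GRing.Theory Num.Theory.
Import numFieldNormedType.Exports.

Local Open Scope classical_set_scope.
Local Open Scope ring_scope.
Local Open Scope ereal_scope.

Lemma profileP {R : realType} (nu : R -> \bar R) (a : R) :
  admissible_profile nu ->
  nu a = -oo \/ exists2 r, nu a = r%:E & (0 <= r <= 1)%R.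
Proof.
move=> nu_adm; case: (profile_range nu_adm a) => [|/andP[]]; first by left.
by case: (nu a) => [r| |]// r0 r1; right; exists r; rewrite // -!lee_fin r0.
Qed.

Lemma concave_profile_fin {R : realType} (nu : R -> \bar R) (x y t r s : R) :
  admissible_profile nu -> concave_profile nu -> (0 < t < 1)%R ->
  nu x = r%:E -> nu y = s%:E ->
  exists2 w, nu (t * x + (1 - t) * y)%R = w%:E & (t * r + (1 - t) * s <= w)%R.
Proof.
move=> nu_adm nu_concave t01 nux nuy.
have := nu_concave x y t t01; rewrite nux nuy -!EFinM -EFinD.
case: (profileP _ (t * x + (1 - t) * y)%R nu_adm) => [->|[w -> _]]; first by [].
by rewrite lee_fin; exists w.
Qed.

(** Points with [nu a = -oo] contribute [+oo] to the infimum, and a real value of [nu a] is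
    nonnegative, which forces [alpha_min nu <= a]. The range of [a] can thus be traded for
    finiteness of [nu a]. *)
Lemma concave_conjugate_ge {R : realType} (nu : R -> \bar R) (p y : R) :
  admissible_profile nu ->
  (y%:E <= concave_conjugate nu p <->
   forall a r, nu a = r%:E -> (y <= a * p - r + 1)%R).
Proof.
move=> nu_adm; split => [yp a r nua|yp].
  rewrite -lee_fin (le_trans yp)//; apply: ereal_inf_lbound; exists a => /=.
    apply: ereal_inf_lbound; exists a => //=.
    case: (profileP _ a nu_adm) => [|[s ->/andP[s0 _]]]; first by rewrite nua.
    by rewrite lee_fin.
  by rewrite nua.
apply: le_ereal_inf_tmp => _ [a _ <-].
case: (profileP _ a nu_adm) => [->|[r nua _]]; first by rewrite leey.
by rewrite nua -EFinN -!EFinD lee_fin; exact: yp.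
Qed.

(* [eta'] is a supremum of functions affine in [p'], one per point of the
   graph of [nu]. *)
Lemma dual_conjugate_le {R : realType} (nu : R -> \bar R) (p x : R) :
  admissible_profile nu -> alpha_min nu \is a fin_num -> (1 < p)%R ->
  (dual_conjugate nu p <= x%:E <->
   forall a r, nu a = r%:E -> (p * (r - a) - r + 1 <= x)%R).
Proof.
move=> nu_adm amin_fin p1; have q0 : (0 < p - 1)%R by rewrite subr_gt0.
have q_neq0 := lt0r_neq0 q0.
(* As [p - 1] is positive, an upper bound on eta' can be solved for eta and becomes a lower bound on
   an infimum. *)
have -> : dual_conjugate nu p <= x%:E <->
    (1 - (x - 1) / (p - 1))%:E <= concave_conjugate nu (p / (p - 1)).
  have e_fin : concave_conjugate nu (p / (p - 1)) \is a fin_num.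
    by apply: concave_conjugate_fin_num; rewrite // divr_gt0// (lt_trans _ p1).
  rewrite /dual_conjugate -(fineK e_fin); set e := fine _.
  rewrite [X in X <= _](_ : _ = ((p - 1) * (1 - e) + 1)%:E)// !lee_fin.
  by rewrite -lerBrDr mulrC -ler_pdivlMr// lerBlDr addrC -lerBlDr.
apply: iff_trans (concave_conjugate_ge _ _ _ nu_adm) _.
have E a r : (1 - (x - 1) / (p - 1) <= a * (p / (p - 1)) - r + 1)%R =
    (p * (r - a) - r + 1 <= x)%R.
  rewrite -[RHS]subr_ge0 -[LHS]subr_ge0 -(pmulr_rge0 _ q0).
  by congr (0 <= _)%R; field.
by split => H a r /H; rewrite E.
Qed.

(* The slope is the least one dominating the part of the graph to the right of
   [c]; concavity makes it work on the left of [c] too. *)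
Lemma separating_slope {R : realType} (nu : R -> \bar R) (a' c m : R) :
  admissible_profile nu -> concave_profile nu -> (c < m)%R ->
  (forall a r, nu a = r%:E -> a' < r - a -> m <= a)%R ->
  (exists s r, nu s = r%:E /\ (a' < r - s)%R) ->
  exists2 k, (0 < k)%R &
    forall a r, nu a = r%:E -> (r - a - a' <= k * (a - c))%R.
Proof.
move=> nu_adm nu_concave cm leS [s [r0 [nus s_S]]].
pose A := [set z : R | exists b r,
  [/\ nu b = r%:E, (c < b)%R & z = ((r - b - a') / (b - c))%R]].
have ms : (m <= s)%R by exact: leS nus s_S.
have cs : (c < s)%R by exact: lt_le_trans ms.
have sA : A ((r0 - s - a') / (s - c))%R by exists s, r0.
have m1 : (0 <= 1 - m - a')%R.
  case: (profileP _ s nu_adm) => [|[r]]; rewrite nus// => -[<-] /andP[_ ?]; lra.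
have supA : has_sup A.
  split; first by exists ((r0 - s - a') / (s - c))%R.
  (* Slopes with [r - b <= a'] are nonpositive. Otherwise [m <= b] and [r <= 1], so the numerator is
     at most [1 - m - a'] and the denominator at least [m - c]. *)
  exists ((1 - m - a') / (m - c))%R => _ [b [r [nub cb ->]]].
  rewrite ler_pdivrMr ?subr_gt0//.
  have [rb|rb] := leP (r - b)%R a'.
    apply: (@le_trans _ _ 0)%R; first lra.
    by rewrite mulr_ge0 ?divr_ge0// subr_ge0 ltW.
  have mb := leS _ _ nub rb.
  apply: (@le_trans _ _ (1 - m - a'))%R.
    case: (profileP _ b nu_adm) => [|[r']]; rewrite nub// => -[<-] /andP[_ ?]; lra.
  by rewrite -mulrA ler_peMr// mulrC ler_pdivlMr ?subr_gt0// mul1r; lra.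
exists (sup A) => [|a r nua].
  apply: (@lt_le_trans _ _ ((r0 - s - a') / (s - c))%R).
    by rewrite divr_gt0 ?subr_gt0//; lra.
  exact: sup_upper_bound.
have [ac|ca|ac] := ltgtP a c; last first.
- rewrite ac subrr mulr0 leNgt; apply/negP => ra.
  have : (m <= a)%R by apply: leS nua _; lra.
  by rewrite ac; lra.
- rewrite -ler_pdivrMr ?subr_gt0//; apply: sup_upper_bound => //.
  by exists a, r.
(* The right-hand side is the slope from [(a, r - a)] to [(c, a')]. It bounds every slope in [A]: by
   concavity, the chord from [a] to [b] has height at most [w - c] over [c], and [w - c <= a']
   because [c < m]. *)
suff : (sup A <= (a' - r + a) / (c - a))%R.
  by rewrite ler_pdivlMr ?subr_gt0//; lra.
apply: ge_sup; first by exists ((r0 - s - a') / (s - c))%R.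
move=> _ [b [r1 [nub cb ->]]].
have ba : (b - a != 0)%R by rewrite subr_eq0; lra.
have t01 : (0 < (b - c) / (b - a) < 1)%R.
  by rewrite divr_gt0 ?subr_gt0 ?ltr_pdivrMr ?subr_gt0; lra.
have [w nuw tw] := concave_profile_fin _ _ _ _ _ _ nu_adm nu_concave t01 nua nub.
have cE : ((b - c) / (b - a) * a + (1 - (b - c) / (b - a)) * b = c)%R by field.
rewrite cE in nuw.
have wc : (w - c <= a')%R.
  by rewrite leNgt; apply/negP => /(leS _ _ nuw); lra.
have : ((b - c) * r + (c - a) * r1 <= w * (b - a))%R.
  rewrite -ler_pdivrMr ?subr_gt0//; last lra.
  by apply: le_trans tw; rewrite le_eqVlt; apply/orP; left; apply/eqP; field.
have : (w * (b - a) <= (a' + c) * (b - a))%R by rewrite ler_wpM2r; lra.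
rewrite ler_pdivrMr ?subr_gt0// mulrAC ler_pdivlMr ?subr_gt0//; lra.
Qed.

Lemma dual_conjugate_convex {R : realType} (nu : R -> \bar R) (s x y : R) :
  admissible_profile nu -> alpha_min nu \is a fin_num ->
  (0 <= s)%R -> (0 <= 1 - s)%R -> (1 < x)%R -> (1 < y)%R ->
  (fine (dual_conjugate nu (s * x + (1 - s) * y)%R) <=
   s * fine (dual_conjugate nu x) + (1 - s) * fine (dual_conjugate nu y))%R.
Proof.
move=> nu_adm amin_fin s0 s1 x1 y1.
have D_fin p : (1 < p)%R -> dual_conjugate nu p = (fine (dual_conjugate nu p))%:E.
  by move=> p1; rewrite fineK//; exact: dual_conjugate_fin_num.
have D_ge p a r : (1 < p)%R -> nu a = r%:E ->
    (p * (r - a) - r + 1 <= fine (dual_conjugate nu p))%R.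
  move=> p1; apply: (dual_conjugate_le _ _ _ nu_adm amin_fin p1).1.
  by rewrite -D_fin.
set p := (s * x + (1 - s) * y)%R.
have p1 : (1 < p)%R.
  (* The weights may vanish: strictness comes from [y] if [s] is 0, and from [x] otherwise. *)
  rewrite /p; have [->|sn0] := eqVneq s 0%R; first lra.
  have : (0 < s * (x - 1))%R by rewrite mulr_gt0 ?subr_gt0// lt0r sn0.
  have : (0 <= (1 - s) * (y - 1))%R by rewrite mulr_ge0// subr_ge0 ltW.
  lra.
rewrite -lee_fin -D_fin//; apply/dual_conjugate_le => // a r nua.
have := ler_wpM2l s0 (D_ge _ _ _ x1 nua).
have := ler_wpM2l s1 (D_ge _ _ _ y1 nua).
by rewrite /p; lra.
Qed.

(** The infimum [alpha_min] of the dual profile is attained: if the sum were negative at [a'], a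
    witness [a < - a'] would also serve every parameter below some [b > a'], making the dual profile
    [-oo] there and pushing [alpha_min] up to [b]. *)
Lemma dual_profile_ge0 {R : realType} (nu : R -> \bar R) (a' : R) :
  alpha_min (dual_profile nu) <= a'%:E ->
  0 <= a'%:E + ereal_inf [set a%:E | a in [set a : R | a'%:E < nu a - a%:E]].
Proof.
move=> a'_min; rewrite leNgt; apply/negP => inf_lt.
have /ereal_inf_lt[_ [a /= a_S <-]] :
    ereal_inf [set a%:E | a in [set a : R | a'%:E < nu a - a%:E]] < (- a')%:E.
  by move: inf_lt; case: (ereal_inf _) => [z| |]//; rewrite ?ltNyr// !lte_fin; lra.
rewrite lte_fin => a_lt.
have [b a'b [b_S ba]] : exists2 b : R, (a' < b)%R & b%:E < nu a - a%:E /\ (b < - a)%R.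
  case: (nu a) a_S => [r| |]//; rewrite ?ltry -?EFinN -?EFinD ?lte_fin => a_S.
    exists ((a' + Num.min (r - a) (- a)) / 2)%R; rewrite ?lte_fin;
    by case: (leP (r - a) (- a))%R => ?; try split; lra.
  by exists ((a' - a) / 2)%R; [lra|split; [rewrite ltry|lra]].
suff : b%:E <= alpha_min (dual_profile nu).
  by move=> /le_trans /(_ a'_min); rewrite lee_fin leNgt a'b.
apply: le_ereal_inf_tmp => _ [b' /= + <-]; rewrite lee_fin => dual_ge0.
rewrite leNgt; apply/negP => b'b; move: dual_ge0; rewrite /dual_profile /clamp.
suff -> : b'%:E +
    ereal_inf [set a%:E | a in [set a : R | b'%:E < nu a - a%:E]] < 0 by [].
apply: (@le_lt_trans _ _ (b'%:E + a%:E)); last by rewrite -EFinD lte_fin; lra.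
rewrite leeD2l//; apply: ereal_inf_lbound; exists a => //=.
by apply: lt_trans b_S; rewrite lte_fin.
Qed.

(** On this range [clamp] acts as the identity: the lower cut-off is excluded by [dual_profile_ge0],
    the upper one because the value 1 at [a'] would give [alpha_max <= a']. *)
Lemma dual_profileE {R : realType} (nu : R -> \bar R) (a' : R) :
  alpha_min (dual_profile nu) <= a'%:E < alpha_max (dual_profile nu) ->
  exists2 m, dual_profile nu a' = (a' + m)%:E &
    ereal_inf [set a%:E | a in [set a : R | a'%:E < nu a - a%:E]] = m%:E.
Proof.
move=> /andP[/dual_profile_ge0 + a'_max]; set M := ereal_inf _ => M_ge0.
have dual_neq1 : dual_profile nu a' <> 1.
  move=> dual1; move: a'_max; rewrite ltNge => /negP; apply.
  by apply: ereal_inf_lbound; exists a'.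
have dualE : dual_profile nu a' = if a'%:E + M <= 1 then a'%:E + M else 1.
  by rewrite /dual_profile /clamp ltNge M_ge0.
move: dual_neq1; rewrite dualE; case: ifPn => // M_le1 _.
have M_fin : M \is a fin_num.
  by move: M_ge0 M_le1; case: (M).
by exists (fine M); rewrite ?EFinD fineK.
Qed.

Theorem proposition4p5 (R : realType) (nu : R -> \bar R)
    (nu_adm : admissible_profile nu)
    (amin_fin : alpha_min nu \is a fin_num)
    (nu_concave : concave_profile nu) :
  convex_function (`]1%R, +oo[%classic : set R^o)
    (fun p' : R^o => fine (dual_conjugate nu p'))
  /\ forall a' : R,
      alpha_min (dual_profile nu) <= a'%:E < alpha_max (dual_profile nu) ->
      dual_profile nu a' =
        ereal_sup [set (a' * p')%:E - dual_conjugate nu p' + 1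
                  | p' in [set p' : R | (1 < p')%R]].
Proof.
split.
  move=> t x y; rewrite !inE /= !in_itv /= !andbT => x1 y1.
  by apply: (dual_conjugate_convex nu t%:num); rewrite // subr_ge0.
move=> a' /dual_profileE[m -> infE].
have leS a r : nu a = r%:E -> (a' < r - a -> m <= a)%R.
  move=> nua ra; rewrite -lee_fin -infE; apply: ereal_inf_lbound; exists a => //=.
  by rewrite nua -EFinD lte_fin.
(* The infimum [m] need not be attained, so only near-minimizers are available. *)
have geS (c : R) : (m < c)%R -> exists a r, [/\ nu a = r%:E, (a' < r - a)%R & (a < c)%R].
  rewrite -lte_fin -infE => /ereal_inf_lt[_ [a /= a_S <-]]; rewrite lte_fin => ac.
  case: (profileP _ a nu_adm) => [nua|[r nua _]]; first by move: a_S; rewrite nua.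
  by exists a, r; split => //; move: a_S; rewrite nua -EFinD lte_fin.
apply/eqP; rewrite eq_le; apply/andP; split.
- apply/lee_addgt0Pr => e e0.
  have [k k0 kP] : exists2 k, (0 < k)%R &
      forall a r, nu a = r%:E -> (r - a - a' <= k * (a - (m - e)))%R.
    apply: (separating_slope _ _ _ m nu_adm nu_concave); [lra|exact: leS|].
    have [a [r [nua ra _]]] := geS (m + 1)%R ltac:(lra).
    by exists a, r.
  (* With [p' = 1 + k^-1], dividing the inequality of the line through [(m - e, a')] by [k] gives
     exactly the required bound on eta'. *)
  have p1 : (1 < 1 + k^-1)%R by rewrite ltrDl invr_gt0.
  rewrite -leeBlDr//; apply: le_ereal_sup_tmp.
  exists ((a' * (1 + k^-1))%:E - dual_conjugate nu (1 + k^-1) + 1).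
    by exists (1 + k^-1)%R.
  have : dual_conjugate nu (1 + k^-1) <= (a' * (1 + k^-1) + 1 - (a' + m - e))%:E.
    apply/dual_conjugate_le => // a r /kP.
    by rewrite mulrC -ler_pdivrMr//; lra.
  have := dual_conjugate_fin_num nu_adm amin_fin p1.
  case: (dual_conjugate _ _) => [d| |]// _; rewrite !lee_fin; lra.
- apply: ge_ereal_sup => _ [p /= p1 <-].
  have := dual_conjugate_fin_num nu_adm amin_fin p1.
  have := (dual_conjugate_le _ _ (fine (dual_conjugate nu p)) nu_adm amin_fin p1).1.
  case: (dual_conjugate _ _) => [d| |]//= /(_ (lexx _)) dP _.
  rewrite -!EFinD lee_fin; apply/ler_addgt0Pr => e e0.
  (* At a near-minimizer, the dual value is at most [a' + a - (p - 1) * (r - a - a')], and the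
     subtracted term is nonnegative. *)
  have [a [r [/dP dP_ar ra am]]] := geS (m + e)%R ltac:(lra).
  have : (0 <= (p - 1) * (r - a - a'))%R by rewrite mulr_ge0// subr_ge0 ltW.
  lra.
Qed.
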